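(* Let $q$ be an odd prime power and let $L$ be a line of $\mathrm{PG}(5,q)$ in the $K$-orbit $o_{13,2}$. Then the hyperplane-orbit distribution of $L$ is $OD_4(L)=\left[1,\,\frac{q^2+3q}{2},\,\frac{q^2+q}{2},\,q^3-q\right]$.
   Context: A point $(y_0,\dots,y_5)$ of $\mathrm{PG}(5,q)$ is identified with the nonzero symmetric matrix $\begin{bmatrix} y_0&y_1&y_2\\ y_1&y_3&y_4\\ y_2&y_4&y_5\end{bmatrix}$ up to scalar. $K\cong\mathrm{PGL}(3,q)$ acts by $M\mapsto AMA^T$, $A\in\mathrm{GL}(3,q)$. The orbit $o_{13,2}$ (defined only for $q$ odd) is the $K$-orbit of the line $\left\{\begin{bmatrix} 0&x&0\\ x&y&0\\ 0&0&-\delta y\end{bmatrix}:(x,y)\in\mathrm{PG}(1,q)\right\}$, where $\delta$ is a non-square in $\mathbb F_q$. Hyperplanes correspond to conics of $\mathrm{PG}(2,q)$ (nonzero quadratic forms up to scalar): $\sum_{0\le i\le j\le2}a_{ij}X_iX_j$ corresponds to $a_{00}Y_0+a_{01}Y_1+a_{02}Y_2+a_{11}Y_3+a_{12}Y_4+a_{22}Y_5=0$. $\mathcal H_1,\mathcal H_{2,r},\mathcal H_{2,i},\mathcal H_3$ are the sets of hyperplanes corresponding respectively to double lines (scalar multiples of squares of linear forms), pairs of distinct real lines (products of two non-proportional linear forms over $\mathbb F_q$), pairs of conjugate imaginary lines (scalar multiples of products of two non-proportional linear forms conjugate over $\mathbb F_{q^2}$), and non-singular conics (those with $4a_{00}a_{11}a_{22}+a_{01}a_{02}a_{12}-a_{00}a_{12}^2-a_{11}a_{02}^2-a_{22}a_{01}^2\ne0$).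 $OD_4(L)=[h_1,h_{2,r},h_{2,i},h_3]$ lists the numbers of hyperplanes in $\mathcal H_1,\mathcal H_{2,r},\mathcal H_{2,i},\mathcal H_3$ containing $L$. *)

(* Defs.v *)
From HB Require Import structures.
From mathcomp Require Import all_boot all_order all_algebra.
From mathcomp Require Import mpoly.
Set Implicit Arguments.
Unset Strict Implicit.
Unset Printing Implicit Defensive.
Import Order.TTheory GRing.Theory.
Local Open Scope ring_scope.

(* A subspace of PG(5,q) is represented by the set of all vectors (zero       *)
(* included) of the corresponding vector subspace of F^6, so that a set of    *)
(* subspaces is an element of {set {set 'rV[F]_6}}.                           *)

(* Position in (y_0, ..., y_5) of the (i, j) entry of a symmetric 3 x 3       *)
(* matrix.                                                                    *)
Definition symidx (i j : 'I_3) : 'I_6 :=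
  inord (nth 0%N (nth [::] [:: [:: 0; 1; 2]; [:: 1; 3; 4]; [:: 2; 4; 5]]%N i) j).

Definition sym_mx (F : finFieldType) (y : 'rV[F]_6) : 'M[F]_3 :=
  \matrix_(i < 3, j < 3) y 0 (symidx i j).

(* Inverse of sym_mx on symmetric matrices: only the upper triangle is read.  *)
Definition sym_coords (F : finFieldType) (M : 'M[F]_3) : 'rV[F]_6 :=
  \row_(k < 6) nth 0 [:: M 0 0; M 0 1; M 0 2; M 1 1; M 1 2; M 2 2] k.

Definition K_act (F : finFieldType) (A : 'M[F]_3) (y : 'rV[F]_6) : 'rV[F]_6 :=
  sym_coords (A *m sym_mx y *m A^T).

Definition K_orbit (F : finFieldType) (U : {set 'rV[F]_6}) :
    {set {set 'rV[F]_6}} :=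
  [set K_act A @: U | A : 'M[F]_3 in unitmx].

Definition line13_2_mx (F : finFieldType) (delta x y : F) : 'M[F]_3 :=
  \matrix_(i < 3, j < 3)
    nth 0 (nth [::] [:: [:: 0; x; 0];
                        [:: x; y; 0];
                        [:: 0; 0; - (delta * y)]] i) j.

Definition line13_2 (F : finFieldType) (delta : F) : {set 'rV[F]_6} :=
  [set sym_coords (line13_2_mx delta x y) | x : F, y : F].

Definition o13_2 (F : finFieldType) (delta : F) : {set {set 'rV[F]_6}} :=
  K_orbit (line13_2 delta).

(* The row a lists a_00, a_01, a_02, a_11, a_12, a_22.                        *)
Definition qform (F : finFieldType) (a : 'rV[F]_6) : {mpoly F[3]} :=
  \sum_(i < 3) \sum_(j < 3 | (i <= j)%N) a 0 (symidx i j) *: ('X_i * 'X_j).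

Definition linform (F : finFieldType) (l : 'rV[F]_3) : {mpoly F[3]} :=
  \sum_(i < 3) l 0 i *: 'X_i.

Definition conic_disc (F : finFieldType) (a : 'rV[F]_6) : F :=
  let c i j := a 0 (symidx i j) in
  4 * c 0 0 * c 1 1 * c 2 2 + c 0 1 * c 0 2 * c 1 2
  - c 0 0 * c 1 2 ^+ 2 - c 1 1 * c 0 2 ^+ 2 - c 2 2 * c 0 1 ^+ 2.

Definition double_line (F : finFieldType) (a : 'rV[F]_6) : bool :=
  [exists c : F, exists l : 'rV[F]_3, qform a == c *: linform l ^+ 2].

(* Two linear forms are non-proportional when their coefficient vectors are   *)
(* linearly independent.                                                      *)
Definition real_line_pair (F : finFieldType) (a : 'rV[F]_6) : bool :=
  [exists l : 'rV[F]_3, exists m : 'rV[F]_3,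
    row_free (col_mx l m) && (qform a == linform l * linform m)].

(* E is meant to be a quadratic extension of F, so that x |-> x ^+ #|F| is    *)
(* its non-trivial automorphism over F.                                       *)
Definition imaginary_line_pair (F E : finFieldType) (iota : {rmorphism F -> E})
    (a : 'rV[F]_6) : bool :=
  [exists c : F, exists l : 'rV[E]_3,
    let lbar := map_mx (fun x : E => x ^+ #|F|) l in
    row_free (col_mx l lbar)
    && (map_mpoly iota (qform a) == iota c *: (linform l * linform lbar))].

Definition nonsingular_conic (F : finFieldType) (a : 'rV[F]_6) : bool :=
  conic_disc a != 0.

Definition hyperplane (F : finFieldType) (a : 'rV[F]_6) : {set 'rV[F]_6} :=
  [set y : 'rV[F]_6 | \sum_(k < 6) a 0 k * y 0 k == 0].

Definition hyperplanes (F : finFieldType) (P : pred 'rV[F]_6) :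
    {set {set 'rV[F]_6}} :=
  [set hyperplane a | a : 'rV[F]_6 & (a != 0) && P a].

Definition num_containing (F : finFieldType) (L : {set 'rV[F]_6})
    (HH : {set {set 'rV[F]_6}}) : nat :=
  #|[set H in HH | L \subset H]|.

Definition OD4 (F E : finFieldType) (iota : {rmorphism F -> E})
    (L : {set 'rV[F]_6}) : seq nat :=
  [:: num_containing L (hyperplanes (@double_line F));
      num_containing L (hyperplanes (@real_line_pair F));
      num_containing L (hyperplanes (imaginary_line_pair iota));
      num_containing L (hyperplanes (@nonsingular_conic F))].

(* Main.v *)
Require Import Defs.
From mathcomp Require Import all_boot all_order all_algebra.
From mathcomp Require Import all_fingroup all_solvable all_field.
From mathcomp Require Import mpoly.
From mathcomp Require Import ring zify.
Import Order.TTheory GRing.Theory.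
Local Open Scope ring_scope.
Set Implicit Arguments.
Unset Strict Implicit.
Unset Printing Implicit Defensive.

(* A conic a is determined by its Gram matrix (the matrix of 2a), on which A
   acts by congruence; this action is dual to K on PG(5,q) and preserves the
   four types of conics, so L may be taken to be the representative line. The
   hyperplanes through it are the conics
     a X^2 + b XZ + delta s Y^2 + c YZ + s Z^2.
   Such a conic is singular iff a (c^2 - 4 delta s^2) + delta s b^2 = 0, and
   since delta is a non-square c^2 - 4 delta s^2 vanishes only at c = s = 0.
   The singular conics with s = 0 are reducible over F (and only X^2 is a
   double line); those with s <> 0 are parametrized by (s, b, c / s), and their
   two lines are real iff c^2 - 4 delta s^2 is a square, which happens for
   (q - 1) / 2 of the ratios c / s. All counts are made on vectors, hence are
   q - 1 times the numbers of hyperplanes. *)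

(** * Characteristic of a finite field of odd order *)

Lemma pchar_card_pnat (F : finFieldType) (p : nat) :
  p \in [pchar F] -> p.-nat #|F|.
Proof. by move=> pF; rewrite -cardsT; apply: (pprimeChar_pgroup pF). Qed.

Lemma odd_card_two_neq0 (F : finFieldType) : odd #|F| -> (2 : F) != 0.
Proof.
move=> odd_q; apply/negP=> F2.
have /pchar_card_pnat/p_natP[[|k] q2] : 2%N \in [pchar F] by rewrite inE.
  by have := finRing_gt1 F; rewrite q2.
by move: odd_q; rewrite q2 oddX.
Qed.

(** * The map x -> x^q on an extension of F, and square roots in a quadratic extension *)

Section QuadraticExtension.
Variables (F E : finFieldType) (iota : {rmorphism F -> E}).

(** The order of F is a power of the characteristic, which E shares with F. *)
Lemma frobD : {morph (fun x : E => x ^+ #|F|) : x y / x + y}.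
Proof.
move=> x y; apply: exprDn_pchar.
have [p pr_p pchp] := finPcharP F.
have pE : p \in [pchar E] by rewrite (fmorph_pchar iota).
by rewrite (eq_pnat _ (pcharf_eq pE)) pchar_card_pnat.
Qed.

Lemma frob_sum (I : Type) (r : seq I) (f : I -> E) :
  (\sum_(i <- r) f i) ^+ #|F| = \sum_(i <- r) f i ^+ #|F|.
Proof.
apply: (big_morph (fun x : E => x ^+ #|F|)); first exact: frobD.
by rewrite expr0n; case: #|F| (finRing_gt1 F).
Qed.

Lemma frobN (x : E) : (- x) ^+ #|F| = - x ^+ #|F|.
Proof.
apply/eqP; rewrite -addr_eq0 -frobD addNr expr0n.
by case: #|F| (finRing_gt1 F).
Qed.

Lemma frob_rmorph (x : F) : iota x ^+ #|F| = iota x.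
Proof. by rewrite -rmorphXn expf_card. Qed.

(** X^q - X is the product of X - x over all x in F, so a root of it in E annihilates one of these
    factors. *)
Lemma frob_fixed (t : E) : t ^+ #|F| = t -> exists x, t = iota x.
Proof.
move=> tq.
have /(congr1 (fun p => (map_poly iota p).[t])) := finField_genPoly F.
rewrite rmorphB rmorph_prod /= map_polyXn map_polyX horner_prod !hornerE.
rewrite tq subrr => /esym/eqP/prodf_eq0[x _].
rewrite rmorphB /= map_polyX map_polyC !hornerE subr_eq0 => /eqP ->.
by exists x.
Qed.

Hypotheses (quadE : #|E| = (#|F| ^ 2)%N) (odd_q : odd #|F|).

Lemma frobK (x : E) : (x ^+ #|F|) ^+ #|F| = x.
Proof. by rewrite -exprM mulnn -quadE expf_card. Qed.

(** The group E^* is cyclic of order (q + 1)(q - 1). A nonzero n in F satisfies n^(q - 1) = 1, so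
    its exponent k with respect to a generator is a multiple of q + 1, which is even because q is
    odd. *)
Lemma rmorph_is_square (n : F) : exists t : E, t ^+ 2 = iota n.
Proof.
have [->|n0] := eqVneq n 0; first by exists 0; rewrite rmorph0 expr0n.
have /cyclicP[g gen] := field_unit_group_cyclic [set: {unit E}]%G.
have q1 : (1 < #|F|)%N := finRing_gt1 F.
have og : #[g]%g = (#|F| ^ 2).-1 by rewrite orderE -gen card_finField_unit quadE.
have Un : iota n \is a GRing.unit by rewrite fmorph_unit.
have : FinRing.Unit Un \in <[g]>%g by rewrite -gen inE.
case/cycleP=> k nk.
have nE : iota n = val g ^+ k by rewrite -[LHS]/(val (FinRing.Unit Un)) nk FinRing.val_unitX.
have : (FinRing.Unit Un ^+ #|F|.-1 = 1)%g.
  apply: val_inj; rewrite FinRing.val_unitX -rmorphXn; apply: (mulfI (x := iota n)).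
    by rewrite fmorph_eq0.
  by rewrite -rmorphM -exprS prednK ?(ltnW q1) // expf_card mulr1.
rewrite nk -expgM => /eqP; rewrite -order_dvdn og => dv.
have ev : ~~ odd k.
  apply/negP=> ok; move: dv.
  have -> : (#|F| ^ 2).-1 = (#|F|.+1 * #|F|.-1)%N.
    by case: #|F| q1 => // m _; rewrite expnS expn1 /=; nia.
  rewrite dvdn_pmul2r; last by lia.
  move/dvdnP=> [j kj]; move: ok; rewrite kj oddM /= odd_q andbF //.
exists (val g ^+ k./2); rewrite -exprM muln2 nE; congr (_ ^+ _).
by rewrite -[RHS]odd_double_half (negPf ev).
Qed.

End QuadraticExtension.

(** * Explicit coordinates for linear and quadratic forms *)

Lemma sum_ord3 (V : nmodType) (f : 'I_3 -> V) : \sum_i f i = f 0 + f 1 + f 2.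
Proof.
rewrite !big_ord_recl big_ord0 addr0 addrA.
by do !congr (_ + _); congr f; apply/val_inj.
Qed.

Lemma sum_ord6 (V : nmodType) (f : 'I_6 -> V) :
  \sum_k f k = f (inord 0) + f (inord 1) + f (inord 2) + f (inord 3)
    + f (inord 4) + f (inord 5).
Proof.
rewrite !big_ord_recl big_ord0 addr0 !addrA.
by do !congr (_ + _); congr f; apply/val_inj; rewrite /= inordK.
Qed.

Section Coordinates.
Variable R : finFieldType.
Implicit Types (a b : 'rV[R]_6) (l m : 'rV[R]_3).

Definition row6 (x0 x1 x2 x3 x4 x5 : R) : 'rV[R]_6 :=
  \row_k nth 0 [:: x0; x1; x2; x3; x4; x5] k.

Lemma row6E x0 x1 x2 x3 x4 x5 (k : 'I_6) :
  row6 x0 x1 x2 x3 x4 x5 0 k = nth 0 [:: x0; x1; x2; x3; x4; x5] k.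
Proof. by rewrite mxE. Qed.

Lemma symidxC i j : symidx i j = symidx j i.
Proof.
by congr inord; case: i j => [[|[|[|i]]] ?] // [[|[|[|j]]] ?].
Qed.

Lemma row6_symidx x0 x1 x2 x3 x4 x5 (i j : 'I_3) :
  row6 x0 x1 x2 x3 x4 x5 0 (symidx i j) =
  nth 0 (nth [::] [:: [:: x0; x1; x2]; [:: x1; x3; x4]; [:: x2; x4; x5]] i) j.
Proof.
by rewrite mxE; case: i j => [[|[|[|i]]] ?] // [[|[|[|j]]] ?] //; rewrite inordK.
Qed.

Lemma row6P a : exists x0 x1 x2 x3 x4 x5, a = row6 x0 x1 x2 x3 x4 x5.
Proof.
exists (a 0 (inord 0)), (a 0 (inord 1)), (a 0 (inord 2)).
exists (a 0 (inord 3)), (a 0 (inord 4)), (a 0 (inord 5)).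
apply/rowP=> k; rewrite row6E -[in LHS](inord_val k).
by case: k => [[|[|[|[|[|[|k]]]]]] ?].
Qed.

Lemma row6_inj x0 x1 x2 x3 x4 x5 y0 y1 y2 y3 y4 y5 :
  row6 x0 x1 x2 x3 x4 x5 = row6 y0 y1 y2 y3 y4 y5 ->
  [/\ x0 = y0, x1 = y1 & x2 = y2] /\ [/\ x3 = y3, x4 = y4 & x5 = y5].
Proof.
move=> /rowP e.
by have:= (e (inord 0), e (inord 1), e (inord 2), e (inord 3), e (inord 4),
  e (inord 5)); rewrite !row6E !inordK //= => -[] [] [] [] [] -> -> -> -> -> ->.
Qed.

Definition row3 (x0 x1 x2 : R) : 'rV[R]_3 := \row_k nth 0 [:: x0; x1; x2] k.

Lemma row3E x0 x1 x2 (k : 'I_3) : row3 x0 x1 x2 0 k = nth 0 [:: x0; x1; x2] k.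
Proof. by rewrite mxE. Qed.

Lemma row3P l : exists x0 x1 x2, l = row3 x0 x1 x2.
Proof.
exists (l 0 0), (l 0 1), (l 0 2); apply/rowP=> k; rewrite row3E.
by case: k => [[|[|[|k]]] ?] //=; congr (l _ _); apply/val_inj.
Qed.

(** Coefficient row of the product of the linear forms [l] and [m]. *)
Definition line_prod l m : 'rV[R]_6 :=
  row6 (l 0 0 * m 0 0) (l 0 0 * m 0 1 + l 0 1 * m 0 0)
       (l 0 0 * m 0 2 + l 0 2 * m 0 0) (l 0 1 * m 0 1)
       (l 0 1 * m 0 2 + l 0 2 * m 0 1) (l 0 2 * m 0 2).

Lemma line_prodE x0 x1 x2 y0 y1 y2 :
  line_prod (row3 x0 x1 x2) (row3 y0 y1 y2) =
  row6 (x0 * y0) (x0 * y1 + x1 * y0) (x0 * y2 + x2 * y0) (x1 * y1)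
    (x1 * y2 + x2 * y1) (x2 * y2).
Proof. by rewrite /line_prod !row3E. Qed.

Lemma qform_row6 x0 x1 x2 x3 x4 x5 :
  qform (row6 x0 x1 x2 x3 x4 x5) =
  x0 *: ('X_0 * 'X_0) + x1 *: ('X_0 * 'X_1) + x2 *: ('X_0 * 'X_2)
  + x3 *: ('X_1 * 'X_1) + x4 *: ('X_1 * 'X_2) + x5 *: ('X_2 * 'X_2)
  :> {mpoly R[3]}.
Proof.
rewrite /qform sum_ord3; do 3! rewrite big_mkcond sum_ord3 /=.
by rewrite !row6_symidx /= !add0r !addrA.
Qed.

Lemma linform_row3 x0 x1 x2 :
  linform (row3 x0 x1 x2) = x0 *: 'X_0 + x1 *: 'X_1 + x2 *: 'X_2 :> {mpoly R[3]}.
Proof.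
by rewrite /linform sum_ord3 !row3E.
Qed.

Lemma linformM l m : linform l * linform m = qform (line_prod l m).
Proof.
have [x0 [x1 [x2 ->]]] := row3P l; have [y0 [y1 [y2 ->]]] := row3P m.
rewrite line_prodE qform_row6 !linform_row3 -!mul_mpolyC; ring.
Qed.

Lemma qformZ c a : qform (c *: a) = c *: qform a.
Proof.
rewrite /qform scaler_sumr; apply: eq_bigr => i _; rewrite scaler_sumr.
by apply: eq_bigr => j _; rewrite mxE scalerA.
Qed.

(** The six coefficients are recovered from the values at the three unit vectors and at the sums of
    two of them. *)
Lemma qform_inj : injective (@qform R).
Proof.
move=> a b.
have [x0 [x1 [x2 [x3 [x4 [x5 ->]]]]]] := row6P a.
have [y0 [y1 [y2 [y3 [y4 [y5 ->]]]]]] := row6P b.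
rewrite !qform_row6 => e.
have ev (v : 'I_3 -> R) : x0 * (v 0 * v 0) + x1 * (v 0 * v 1) + x2 * (v 0 * v 2)
  + x3 * (v 1 * v 1) + x4 * (v 1 * v 2) + x5 * (v 2 * v 2)
  = y0 * (v 0 * v 0) + y1 * (v 0 * v 1) + y2 * (v 0 * v 2)
  + y3 * (v 1 * v 1) + y4 * (v 1 * v 2) + y5 * (v 2 * v 2).
  by have := congr1 (meval v) e; rewrite !mevalD !mevalZ !mevalM !mevalXU.
have e0 := ev (fun i => nth 0 [:: 1; 0; 0] i).
have e1 := ev (fun i => nth 0 [:: 0; 1; 0] i).
have e2 := ev (fun i => nth 0 [:: 0; 0; 1] i).
have e01 := ev (fun i => nth 0 [:: 1; 1; 0] i).
have e02 := ev (fun i => nth 0 [:: 1; 0; 1] i).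
have e12 := ev (fun i => nth 0 [:: 0; 1; 1] i).
move: e0 e1 e2 e01 e02 e12; rewrite /= !(mulr0, mul0r, mulr1, addr0, add0r).
by move=> -> -> -> /addIr/addrI-> /addIr/addrI-> /addIr/addrI->.
Qed.

End Coordinates.

(** * Gram matrices and the congruence action on conics *)

Lemma det_mx33 (R : comUnitRingType) (S : 'M[R]_3) : \det S =
  S 0 0 * (S 1 1 * S 2 2 - S 1 2 * S 2 1)
  - S 0 1 * (S 1 0 * S 2 2 - S 1 2 * S 2 0)
  + S 0 2 * (S 1 0 * S 2 1 - S 1 1 * S 2 0).
Proof.
pose f m n := S (inord m) (inord n).
have fE i j : S i j = f i j by rewrite /f !inord_val.
rewrite (expand_det_row _ 0) !big_ord_recl big_ord0 /cofactor.
rewrite !(expand_det_row _ 0) !big_ord_recl !big_ord0 /cofactor !det_mx11 !mxE.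
rewrite !fE /= /bump /=. 
by ring.
Qed.

Section Congruence.
Variable R : finFieldType.
Hypothesis two_neq0 : (2 : R) != 0.
Implicit Types (a b y : 'rV[R]_6) (l m : 'rV[R]_3) (A S : 'M[R]_3).

(** Matrix of the polar form: the multiplicity [(i == j).+1] doubles the diagonal, so that no
    coefficient has to be halved. *)
Definition gram a : 'M[R]_3 := \matrix_(i, j) (a 0 (symidx i j) *+ (i == j).+1).

Lemma gramE a i j : gram a i j = a 0 (symidx i j) *+ (i == j).+1.
Proof. by rewrite mxE. Qed.

(** Inverse of [gram] on symmetric matrices in odd characteristic; only the upper triangle is
    read. *)
Definition gram_coords S : 'rV[R]_6 :=
  row6 (S 0 0 / 2) (S 0 1) (S 0 2) (S 1 1 / 2) (S 1 2) (S 2 2 / 2).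

(** Coefficients of the form obtained by the substitution x -> A x. *)
Definition conic_congr A a := gram_coords (A^T *m gram a *m A).

Lemma gram_sym a : (gram a)^T = gram a.
Proof. by apply/matrixP=> i j; rewrite !mxE symidxC eq_sym. Qed.

Lemma gramK : cancel gram gram_coords.
Proof.
move=> a; have [x0 [x1 [x2 [x3 [x4 [x5 ->]]]]]] := row6P a.
rewrite /gram_coords !gramE !row6_symidx /=.
by congr row6; rewrite -[_ *+ 2]mulr_natr mulfK.
Qed.

Lemma mx3P S S' :
  [/\ S 0 0 = S' 0 0, S 0 1 = S' 0 1 & S 0 2 = S' 0 2] ->
  [/\ S 1 0 = S' 1 0, S 1 1 = S' 1 1 & S 1 2 = S' 1 2] ->
  [/\ S 2 0 = S' 2 0, S 2 1 = S' 2 1 & S 2 2 = S' 2 2] -> S = S'.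
Proof.
have o (i : 'I_3) : [\/ i = 0, i = 1 | i = 2].
  by case: i => [[|[|[|i]]] ?] //;
    [apply: Or31|apply: Or32|apply: Or33]; apply/val_inj.
move=> [? ? ?] [? ? ?] [? ? ?]; apply/matrixP=> i j.
by case: (o i) => ->; case: (o j) => ->.
Qed.

Lemma gram_coordsK S : S^T = S -> gram (gram_coords S) = S.
Proof.
move=> /matrixP sS; have sy i j : S i j = S j i by rewrite -(sS i j) mxE.
have d2 (x : R) : x / 2 *+ 2 = x by rewrite -mulr_natr divfK.
by apply: mx3P; split; rewrite gramE row6_symidx /= ?d2 ?mulr1n; first
  [reflexivity | exact: sy].
Qed.

(** Polarization of a product; through it a congruence acts on each of the two lines separately. *)
Lemma gram_line_prod l m : gram (line_prod l m) = l^T *m m + m^T *m l.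
Proof.
have [x0 [x1 [x2 ->]]] := row3P l; have [y0 [y1 [y2 ->]]] := row3P m.
rewrite line_prodE.
by apply: mx3P; split; rewrite gramE row6_symidx !mxE !big_ord1 !mxE /=; ring.
Qed.

Lemma gramZ c a : gram (c *: a) = c *: gram a.
Proof. by apply/matrixP=> i j; rewrite !mxE mulrnAr. Qed.

Lemma gram_congr A a : gram (conic_congr A a) = A^T *m gram a *m A.
Proof. by rewrite gram_coordsK // !trmx_mul trmxK gram_sym mulmxA. Qed.

Lemma conic_congrM A B a :
  conic_congr A (conic_congr B a) = conic_congr (B *m A) a.
Proof. by rewrite /conic_congr gram_congr trmx_mul !mulmxA. Qed.

Lemma conic_congr1 a : conic_congr 1%:M a = a.
Proof. by rewrite /conic_congr trmx1 mul1mx mulmx1 gramK. Qed.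

Lemma conic_congrK A :
  A \in unitmx -> cancel (conic_congr A) (conic_congr (invmx A)).
Proof. by move=> uA a; rewrite conic_congrM mulmxV // conic_congr1. Qed.

Lemma conic_congr_line_prod A l m :
  conic_congr A (line_prod l m) = line_prod (l *m A) (m *m A).
Proof.
apply: (can_inj gramK); rewrite gram_congr !gram_line_prod !trmx_mul.
by rewrite mulmxDr mulmxDl !mulmxA.
Qed.

Lemma conic_congrZ A c a : conic_congr A (c *: a) = c *: conic_congr A a.
Proof.
apply: (can_inj gramK); rewrite gramZ !gram_congr gramZ.
by rewrite -scalemxAr -scalemxAl.
Qed.

Lemma det_gram a : \det (gram a) = 2 * conic_disc a.
Proof.
have [x0 [x1 [x2 [x3 [x4 [x5 ->]]]]]] := row6P a.
rewrite det_mx33 !gramE /conic_disc !row6_symidx /=; ring.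
Qed.

Lemma mulmx3E (S T : 'M[R]_3) i j :
  (S *m T) i j = S i 0 * T 0 j + S i 1 * T 1 j + S i 2 * T 2 j.
Proof.
by rewrite mxE sum_ord3.
Qed.

(** Turns incidence into a trace pairing. The factor 2 appears because the off-diagonal terms occur
    twice in the trace and [gram] doubles the diagonal. *)
Lemma trace_gram a S : S^T = S ->
  \tr (gram a *m S) = 2 * \sum_k a 0 k * sym_coords S 0 k.
Proof.
move=> /matrixP sS; have sy i j : S i j = S j i by rewrite -(sS i j) mxE.
have [x0 [x1 [x2 [x3 [x4 [x5 ->]]]]]] := row6P a.
rewrite sum_ord6 !row6E !inordK //= /mxtrace sum_ord3 !mulmx3E.
rewrite !gramE !row6_symidx /=.
rewrite (sy 1 0) (sy 2 0) (sy 2 1); ring.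
Qed.

Lemma sym_mx_sym y : (sym_mx y)^T = sym_mx y.
Proof. by apply/matrixP=> i j; rewrite !mxE symidxC. Qed.

Lemma sym_mxK y : sym_coords (sym_mx y) = y.
Proof.
have [x0 [x1 [x2 [x3 [x4 [x5 ->]]]]]] := row6P y.
have mxy i j : sym_mx (row6 x0 x1 x2 x3 x4 x5) i j =
  row6 x0 x1 x2 x3 x4 x5 0 (symidx i j) by rewrite mxE.
rewrite -[LHS]/(row6 _ _ _ _ _ _) !mxy !row6_symidx //.
Qed.

(** Cyclicity of the trace: tr(G A Y A^T) = tr(A^T G A Y). Hence congruence is dual to the action of
    K on points. *)
Lemma mem_hyperplane_K_act A a y :
  (K_act A y \in hyperplane a) = (y \in hyperplane (conic_congr A a)).
Proof.
have h (S : 'M[R]_3) b : S^T = S ->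
    (sym_coords S \in hyperplane b) = (\tr (gram b *m S) == 0).
  by move=> sS; rewrite trace_gram // inE mulf_eq0 (negPf two_neq0).
rewrite -[y in RHS]sym_mxK /K_act !h ?sym_mx_sym //; last first.
  by rewrite !trmx_mul trmxK sym_mx_sym mulmxA.
by rewrite gram_congr mxtrace_mulC -!mulmxA mxtrace_mulC -!mulmxA mxtrace_mulC
  !mulmxA.
Qed.

Lemma subset_hyperplane_K_act A a (U : {set 'rV[R]_6}) :
  (K_act A @: U \subset hyperplane a) = (U \subset hyperplane (conic_congr A a)).
Proof.
apply/subsetP/subsetP=> sub y.
  by move=> Uy; rewrite -mem_hyperplane_K_act sub ?imset_f.
by case/imsetP=> z Uz ->; rewrite mem_hyperplane_K_act sub.
Qed.

End Congruence.

(** * Pairs of lines in coordinates, and the discriminant *)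

Section Singular.
Variable R : finFieldType.
Implicit Types (a : 'rV[R]_6) (l m : 'rV[R]_3).

(** Rank two is detected by the 2 x 2 minors, which later turn out to be square roots of
    discriminants. *)
Lemma row_free2 x0 x1 x2 y0 y1 y2 :
  row_free (col_mx (row3 x0 x1 x2) (row3 y0 y1 y2) : 'M[R]_(1 + 1, 3)) =
  [|| x0 * y1 - x1 * y0 != 0, x0 * y2 - x2 * y0 != 0 | x1 * y2 - x2 * y1 != 0].
Proof.
have comb (u v : R) : row_mx u%:M v%:M *m col_mx (row3 x0 x1 x2) (row3 y0 y1 y2)
    = row3 (u * x0 + v * y0) (u * x1 + v * y1) (u * x2 + v * y2).
  rewrite mul_row_col !mul_scalar_mx; apply/rowP=> k; rewrite !mxE.
  by case: k => [[|[|[|k]]] ?].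
have row3_0 : row3 0 0 0 = 0 :> 'rV[R]_3.
  by apply/rowP=> k; rewrite !mxE; case: k => [[|[|[|k]]] ?].
apply/idP/idP=> [free|w].
  (* If all minors vanish, the coefficients [(y_i, - x_i)] give a linear relation between the rows
     for each i; freeness then makes every entry zero. *)
  apply/negPn/negP; rewrite !negb_or !negbK => /and3P[/eqP w01 /eqP w02 /eqP w12].
  have ker u v : row3 (u * x0 + v * y0) (u * x1 + v * y1) (u * x2 + v * y2) = 0
      -> u = 0 /\ v = 0.
    rewrite -comb => /eqP; rewrite mulmx_free_eq0 // => /eqP.
    rewrite -[0]row_mx0 => /eq_row_mx[/matrixP/(_ 0 0) + /matrixP/(_ 0 0)].
    by rewrite !mxE.
  have [x0z y0z] : x0 = 0 /\ y0 = 0.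
    have [|] := ker y0 (- x0); last by move=> -> /eqP; rewrite oppr_eq0 => /eqP.
    by rewrite -row3_0; congr row3; [ring|rewrite -oppr0 -w01; ring|
      rewrite -oppr0 -w02; ring].
  have [x1z y1z] : x1 = 0 /\ y1 = 0.
    have [|] := ker y1 (- x1); last by move=> -> /eqP; rewrite oppr_eq0 => /eqP.
    by rewrite -row3_0; congr row3; [rewrite -w01; ring|ring|
      rewrite -oppr0 -w12; ring].
  have [x2z y2z] : x2 = 0 /\ y2 = 0.
    have [|] := ker y2 (- x2); last by move=> -> /eqP; rewrite oppr_eq0 => /eqP.
    by rewrite -row3_0; congr row3; [rewrite -w02; ring|rewrite -w12; ring|
      ring].
  have [] := ker 1 0; last by move=> /eqP; rewrite oner_eq0.
  by rewrite x0z x1z x2z !mulr0 !mul0r !addr0.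
apply: inj_row_free => v; rewrite -[v]hsubmxK [lsubmx v]mx11_scalar
  [rsubmx v]mx11_scalar comb -row3_0; move: (lsubmx v 0 0) (rsubmx v 0 0) => s t.
move=> /rowP e; have := (e 0, e 1, e 2); rewrite !row3E /= => -[[e0 e1] e2].
suff [-> ->] : s = 0 /\ t = 0.
  by apply/rowP=> k; rewrite !mxE; case: split => ?; rewrite mxE mul0rn.
(* Cramer's rule for a nonzero minor. *)
have kill p q p' q' : s * p + t * q = 0 -> s * p' + t * q' = 0 ->
    p * q' - p' * q != 0 -> s = 0 /\ t = 0.
  move=> h h' d; split; apply: (mulIf d); rewrite mul0r.
    transitivity ((s * p + t * q) * q' - (s * p' + t * q') * q); first ring.
    by rewrite h h'; ring.
  transitivity ((s * p' + t * q') * p - (s * p + t * q) * p'); first ring.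
  by rewrite h h'; ring.
by case/or3P: w; apply: kill.
Qed.

Lemma double_lineP a :
  reflect (exists c l, a = c *: line_prod l l) (double_line a).
Proof.
apply: (iffP existsP) => -[c].
  move=> /existsP[l /eqP e]; exists c, l; apply: qform_inj.
  by rewrite e qformZ -linformM expr2.
by case=> l ->; exists c; apply/existsP; exists l; rewrite qformZ -linformM expr2.
Qed.

Lemma real_line_pairP a :
  reflect (exists l m, row_free (col_mx l m) /\ a = line_prod l m)
    (real_line_pair a).
Proof.
apply: (iffP existsP) => -[l].
  case/existsP=> m /andP[fr /eqP e]; exists l, m; split=> //; apply: qform_inj.
  by rewrite e linformM.
case=> m [fr ->]; exists l; apply/existsP; exists m.
by rewrite fr linformM /=.
Qed.

Lemma conic_disc_row6 x0 x1 x2 x3 x4 x5 : conic_disc (row6 x0 x1 x2 x3 x4 x5) =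
  4 * x0 * x3 * x5 + x1 * x2 * x4 - x0 * x4 ^+ 2 - x3 * x2 ^+ 2 - x5 * x1 ^+ 2
  :> R.
Proof. by rewrite /conic_disc !row6_symidx. Qed.

Lemma conic_disc_line_prod l m : conic_disc (line_prod l m) = 0.
Proof.
have [x0 [x1 [x2 ->]]] := row3P l; have [y0 [y1 [y2 ->]]] := row3P m.
rewrite line_prodE conic_disc_row6; ring.
Qed.

Lemma conic_discZ c a : conic_disc (c *: a) = c ^+ 3 * conic_disc a.
Proof. rewrite /conic_disc !mxE; ring. Qed.

Lemma row6Z c x0 x1 x2 x3 x4 x5 : c *: row6 x0 x1 x2 x3 x4 x5 =
  row6 (c * x0) (c * x1) (c * x2) (c * x3) (c * x4) (c * x5) :> 'rV[R]_6.
Proof.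
by apply/rowP=> k; rewrite !mxE; case: k => [[|[|[|[|[|[|k]]]]]] ?].
Qed.

Lemma row6_eq0 x0 x1 x2 x3 x4 x5 : (row6 x0 x1 x2 x3 x4 x5 == 0 :> 'rV[R]_6) =
  [&& x0 == 0, x1 == 0, x2 == 0, x3 == 0, x4 == 0 & x5 == 0].
Proof.
have -> : 0 = row6 0 0 0 0 0 0 :> 'rV[R]_6 by rewrite -[in RHS](mul0r 0) -row6Z scale0r.
apply/eqP/and5P=> [/row6_inj[[-> -> ->] [-> -> ->]]|]; first by rewrite !eqxx.
by case=> /eqP-> /eqP-> /eqP-> /eqP-> /andP[/eqP-> /eqP->].
Qed.

End Singular.

(** * Base change to E and conjugate lines *)

Section Imaginary.
Variables (F E : finFieldType) (iota : {rmorphism F -> E}).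

Lemma map_row6 x0 x1 x2 x3 x4 x5 :
  map_mx iota (row6 x0 x1 x2 x3 x4 x5) =
  row6 (iota x0) (iota x1) (iota x2) (iota x3) (iota x4) (iota x5).
Proof.
by apply/rowP=> k; rewrite !mxE; case: k => [[|[|[|[|[|[|k]]]]]] ?].
Qed.

Lemma qform_map (a : 'rV[F]_6) :
  map_mpoly iota (qform a) = qform (map_mx iota a).
Proof.
have [x0 [x1 [x2 [x3 [x4 [x5 ->]]]]]] := row6P a.
by rewrite map_row6 !qform_row6 !rmorphD /= !map_mpolyZ !rmorphM /= !map_mpolyX.
Qed.

Definition frob_mx n (l : 'rV[E]_n) := map_mx (fun x : E => x ^+ #|F|) l.

Lemma imaginary_line_pairP (a : 'rV[F]_6) :
  reflect (exists c l, row_free (col_mx l (frob_mx l)) /\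
             map_mx iota a = iota c *: line_prod l (frob_mx l))
    (imaginary_line_pair iota a).
Proof.
apply: (iffP existsP) => -[c].
  move=> /existsP[l /andP[fr /eqP e]]; exists c, l; split=> //; apply: qform_inj.
  by rewrite -qform_map e qformZ -linformM.
case=> l [fr e]; exists c; apply/existsP; exists l.
by apply/andP; split; [exact: fr | rewrite qform_map e qformZ -linformM].
Qed.

Lemma map_gram (a : 'rV[F]_6) : map_mx iota (gram a) = gram (map_mx iota a).
Proof. by apply/matrixP=> i j; rewrite !mxE rmorphMn. Qed.

(** Conjugation commutes with matrices over F, so a change of coordinates over F keeps conjugate
    lines conjugate. *)
Lemma frob_mxM n (l : 'rV[E]_n) p (A : 'M[F]_(n, p)) :
  frob_mx (l *m map_mx iota A) = frob_mx l *m map_mx iota A.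
Proof.
apply/rowP=> k; rewrite !mxE (frob_sum iota); apply: eq_bigr => i _.
by rewrite !mxE exprMn frob_rmorph.
Qed.
End Imaginary.

(** * Explicit factorization of a singular conic *)

Section Split.
Variable R : finFieldType.

Lemma line_prodZl c (l m : 'rV[R]_3) : line_prod (c *: l) m = c *: line_prod l m.
Proof. by rewrite /line_prod row6Z !mxE; congr row6; ring. Qed.

(** On X = 0 the form is s (u Y + Z)(v Y + Z), by the quadratic formula. The X-coefficients of the
    factors are then forced by the vanishing XY term and the XZ term b; the hypothesis on [a] gives
    the X^2 term. It serves over F for real pairs and over E for imaginary ones. *)
Lemma line_prod_split (a b c d s t : R) : (2 : R) != 0 -> s != 0 -> t != 0 ->
  t ^+ 2 = c ^+ 2 - 4 * d * s ^+ 2 -> a * t ^+ 2 = - (d * s * b ^+ 2) ->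
  let u := (c + t) / (2 * s) in let v := (c - t) / (2 * s) in
  row6 a 0 b (d * s) c s =
  s *: line_prod (row3 (b * u / t) u 1) (row3 (- (b * v / t)) v 1).
Proof.
move=> two s0 t0 tE aE u v.
have four : (4 : R) != 0 by rewrite (_ : 4 = 2 * 2) ?mulf_neq0 //; ring.
rewrite line_prodE row6Z; congr row6.
- have t20 : t ^+ 2 != 0 by rewrite expf_neq0.
  apply: (mulIf t20); rewrite aE.
  have -> : d = (c ^+ 2 - t ^+ 2) / (4 * s ^+ 2).
    by rewrite tE; field; rewrite s0 four.
  by rewrite /u /v; field; rewrite ?s0 ?t0 ?two ?four.
- by rewrite /u /v; field; rewrite ?s0 ?t0 ?two ?four.
- by rewrite /u /v; field; rewrite ?s0 ?t0 ?two ?four.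
- rewrite /u /v.
  transitivity ((c ^+ 2 - t ^+ 2) / (4 * s)); last by field; rewrite ?s0 ?two ?four.
  by rewrite tE; field; rewrite ?s0 ?two ?four.
- by rewrite /u /v; field; rewrite ?s0 ?two ?four.
- by ring.
Qed.

End Split.

(** * Types of the conics through the representative line *)

Section Classification.
Variables (F E : finFieldType) (iota : {rmorphism F -> E}).
Hypotheses (quadE : #|E| = (#|F| ^ 2)%N) (odd_q : odd #|F|).

Let two : (2 : F) != 0 := odd_card_two_neq0 odd_q.
Let twoE : (2 : E) != 0.
Proof. by apply: odd_card_two_neq0; rewrite quadE oddX. Qed.

Lemma map_conic_congr A (a : 'rV[F]_6) :
  map_mx iota (conic_congr A a) = conic_congr (map_mx iota A) (map_mx iota a).
Proof.
apply: (can_inj (gramK twoE)).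
by rewrite -map_gram !gram_congr // !map_mxM map_trmx map_gram.
Qed.

(** The map x -> x^q is an involution of E, so it swaps the rows of a minor of a form and its
    conjugate. *)
Lemma frob_anti (x y z t : E) : x ^+ #|F| = z -> y ^+ #|F| = t ->
  (x * t - y * z) ^+ #|F| = - (x * t - y * z).
Proof.
move=> <- <-; rewrite (frobD iota) (frobN iota) !exprMn !(frobK quadE); ring.
Qed.

(** The second equation gives n w = r or - r, so w lies in F and is fixed by x -> x^q; being also
    negated, it is zero. *)
Lemma frob_anti_sqrt (w : E) (r n : F) : n != 0 ->
  w ^+ #|F| = - w -> iota r ^+ 2 = (iota n * w) ^+ 2 -> w = 0.
Proof.
move=> n0 wq /eqP; rewrite eqf_sqr => rw.
have in0 : iota n != 0 by rewrite fmorph_eq0.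
have : exists x, w = iota x.
  case/orP: rw => /eqP rw; [exists (r / n) | exists (- r / n)].
    by rewrite fmorph_div rw mulrAC mulfV ?mul1r.
  by rewrite fmorph_div rmorphN rw opprK mulrAC mulfV ?mul1r.
case=> x wx; move: wq; rewrite wx frob_rmorph => /eqP.
rewrite -addr_eq0 -mulr2n -mulr_natl mulf_eq0 (negPf twoE) /=.
by move/eqP.
Qed.

(** Zero counts as a square. *)
Definition is_sq (n : F) := [exists x : F, x ^+ 2 == n].

(** Conjugation sends t to t or - t, and t^q = t would put the root in F. *)
Lemma frob_sqrt (n : F) : ~~ is_sq n ->
  exists2 t : E, t ^+ 2 = iota n & t ^+ #|F| = - t.
Proof.
move=> nsq; have [t tn] := rmorph_is_square iota quadE odd_q n.
exists t => //; have : (t ^+ #|F|) ^+ 2 == t ^+ 2.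
  by rewrite -exprM mulnC exprM tn frob_rmorph.
rewrite eqf_sqr => /orP[/eqP tq|/eqP//].
have [x tx] := frob_fixed iota tq.
case/negP: nsq; apply/existsP; exists x; rewrite -(inj_eq (fmorph_inj iota)).
by rewrite rmorphXn -tx tn.
Qed.

Variable delta : F.
Hypothesis nonsq_delta : forall x : F, x ^+ 2 != delta.

(** Vanishing on [line13_2 delta] forces a_01 = 0 and a_11 = delta a_22; the other four coefficients
    are free. *)
Definition conic13 (a b c s : F) := row6 a 0 b (delta * s) c s.

(** If s were nonzero, c / (2 s) would be a square root of delta. *)
Lemma nonsq_anisotropic c s : c ^+ 2 = 4 * delta * s ^+ 2 -> s = 0 /\ c = 0.
Proof.
move=> e; have [s0|s0] := eqVneq s 0.
  split=> //; move: e; rewrite s0 expr0n mulr0 => /eqP.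
  by rewrite sqrf_eq0 => /eqP.
case/eqP: (nonsq_delta (c / (2 * s))); rewrite expr_div_n e.
have -> : (4 : F) = 2 * 2 by ring.
by field; rewrite s0.
Qed.

Lemma conic_disc13 a b c s : conic_disc (conic13 a b c s) =
  - (a * (c ^+ 2 - 4 * delta * s ^+ 2) + delta * s * b ^+ 2).
Proof. rewrite conic_disc_row6; ring. Qed.

Lemma double_line13 a b c s :
  double_line (conic13 a b c s) = [&& b == 0, c == 0 & s == 0].
Proof.
apply/double_lineP/and3P=> [[k [l]]|[/eqP-> /eqP-> /eqP->]]; last first.
  exists a, (row3 1 0 0); rewrite line_prodE row6Z; congr row6; ring.
have [x0 [x1 [x2 ->]]] := row3P l; rewrite line_prodE row6Z.
case/row6_inj=> [[_ e1 eb] [ed ec es]].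
have [s0 c0] : s = 0 /\ c = 0.
  (* A multiple of a square has zero discriminant on the line X = 0; the same on Y = 0 gives b^2 = 4
     a s below. *)
  apply: nonsq_anisotropic.
  transitivity (4 * (delta * s) * s); last by ring.
  by rewrite ed es ec; ring.
rewrite s0 c0 eqxx; split=> //.
rewrite -sqrf_eq0; apply/eqP; transitivity (4 * (k * (x0 * x0)) * s).
  by rewrite eb es; ring.
by rewrite s0 mulr0.
Qed.

(** For s = 0 singularity means a c^2 = 0, and the form splits at once, with b = c = 0 leaving a
    multiple of X^2. For s <> 0 splitting is decided by the discriminant of the restriction to X =
    0. *)
Lemma real_line_pair13 a b c s : real_line_pair (conic13 a b c s) =
  (conic_disc (conic13 a b c s) == 0) &&
  (if s == 0 then (b != 0) || (c != 0) else is_sq (c ^+ 2 - 4 * delta * s ^+ 2)).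
Proof.
apply/real_line_pairP/andP=> [[l [m [fr e]]]|[/eqP]].
  rewrite {1}e conic_disc_line_prod eqxx; split=> //; move: fr e.
  have [x0 [x1 [x2 ->]]] := row3P l; have [y0 [y1 [y2 ->]]] := row3P m.
  rewrite row_free2 line_prodE => fr /row6_inj[[ea e1 eb] [ed ec es]].
  (* The discriminant of the restriction to X = 0 is the square of a minor of the two lines. *)
  have w12 : c ^+ 2 - 4 * delta * s ^+ 2 = (x1 * y2 - x2 * y1) ^+ 2.
    transitivity (c ^+ 2 - 4 * (delta * s) * s); first by ring.
    by rewrite ed es ec; ring.
  case: eqP => [s0|_]; last by apply/existsP; eexists; rewrite w12.
  (* If b = c = s = 0, the discriminants on all three coordinate lines vanish, hence so do all
     minors. *)
  apply: contraLR fr; rewrite !negb_or !negbK => /andP[/eqP b0 /eqP c0].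
  rewrite -(sqrf_eq0 (x0 * y1 - _)) -(sqrf_eq0 (x0 * y2 - _)) -(sqrf_eq0 (x1 * y2 - _)).
  rewrite -w12 c0 s0 !expr0n mulr0 subrr eqxx andbT; apply/andP; split; apply/eqP.
    transitivity (0 ^+ 2 - 4 * a * (delta * s)); first by rewrite ed ea e1; ring.
    by rewrite s0; ring.
  transitivity (b ^+ 2 - 4 * a * s); first by rewrite es ea eb; ring.
  by rewrite s0 b0; ring.
rewrite conic_disc13 => /eqP; rewrite oppr_eq0 addr_eq0 => /eqP dE.
case: eqVneq => [s0|s0].
  move: dE; rewrite s0 expr0n /= !mulr0 mul0r !oppr0 addr0 => /eqP.
  rewrite mulf_eq0 sqrf_eq0 => /orP[] /eqP -> bc.
    (* Case a = 0: the form is Z (b X + c Y). *)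
    exists (row3 0 0 1), (row3 b c 0); rewrite row_free2 line_prodE.
    rewrite !(mul0r, mulr0, mul1r, mulr1, sub0r, oppr_eq0, addr0, add0r, subrr).
    rewrite eqxx /= bc; split=> //; rewrite /conic13; congr row6; ring.
  move: bc; rewrite eqxx orbF => b0.
  (* Case c = 0: the form is X (a X + b Z). *)
  exists (row3 1 0 0), (row3 a 0 b); rewrite row_free2 line_prodE.
  split; first by apply/or3P/Or32; rewrite mul1r mul0r subr0.
  by rewrite /conic13; congr row6; ring.
case/existsP=> t /eqP tE.
have t0 : t != 0.
  apply: contra_neq s0 => t0; have [] // := @nonsq_anisotropic c s.
  by apply/eqP; rewrite -subr_eq0 -tE t0 expr0n.
have aE : a * t ^+ 2 = - (delta * s * b ^+ 2) by rewrite tE dE.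
(* A real pair carries no scalar, so the factor [s] is absorbed into the first line. *)
have := line_prod_split two s0 t0 tE aE => /=; rewrite -line_prodZl /conic13 => ->.
set u := (c + t) / _; set v := (c - t) / _; do 2 eexists; split; last by [].
have -> : s *: row3 (b * u / t) u 1 = row3 (s * (b * u / t)) (s * u) s.
  by apply/rowP=> k; rewrite !mxE; case: k => [[|[|[|k]]] ?] //=; rewrite mulr1.
rewrite row_free2; apply/or3P/Or33.
have -> : s * u * 1 - s * v = t by rewrite /u /v; field; rewrite ?s0 ?two.
by [].
Qed.

Lemma frob_row3 x0 x1 x2 :
  frob_mx F (row3 x0 x1 x2) = row3 (x0 ^+ #|F|) (x1 ^+ #|F|) (x2 ^+ #|F|) :> 'rV[E]_3.
Proof. by apply/rowP=> k; rewrite !mxE; case: k => [[|[|[|k]]] ?]. Qed.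

(** The zero form is excluded because the scalar 0 would make it an imaginary pair. The minors of
    conjugate lines are negated by x -> x^q, so a discriminant that is a square in F forces its
    minor to vanish; conversely a root t in E with t^q = - t yields conjugate factors. *)
Lemma imaginary_line_pair13 a b c s : conic13 a b c s != 0 ->
  imaginary_line_pair iota (conic13 a b c s) =
  [&& conic_disc (conic13 a b c s) == 0, s != 0
    & ~~ is_sq (c ^+ 2 - 4 * delta * s ^+ 2)].
Proof.
move=> nz.
have m13 : map_mx iota (conic13 a b c s) =
    row6 (iota a) 0 (iota b) (iota delta * iota s) (iota c) (iota s).
  by rewrite map_row6 rmorphM rmorph0.
apply/imaginary_line_pairP/and3P=> [[k [l [fr e]]]|[/eqP dE s0 nsq]].
  have k0 : k != 0.
    apply: contraNneq nz => k0; move: e; rewrite k0 rmorph0 scale0r.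
    by move/eqP; rewrite map_mx_eq0.
  have d0 : conic_disc (conic13 a b c s) == 0.
    rewrite -(fmorph_eq0 iota).
    have <- : conic_disc (map_mx iota (conic13 a b c s)) =
        iota (conic_disc (conic13 a b c s)).
      by rewrite map_row6 !conic_disc_row6; ring.
    by rewrite e conic_discZ conic_disc_line_prod mulr0.
  have [x0 [x1 [x2 lE]]] := row3P l.
  move: fr e; rewrite m13 lE frob_row3 row_free2 line_prodE row6Z => fr.
  case/row6_inj=> [[ea e1 eb] [ed ec es]].
  set w01 := _ - _ in fr; set w02 := _ - _ in fr; set w12 := _ - _ in fr.
  have q12 : iota (c ^+ 2 - 4 * delta * s ^+ 2) = (iota k * w12) ^+ 2.
    transitivity (iota c ^+ 2 - 4 * (iota delta * iota s) * iota s); first by ring.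
    by rewrite ed ec es /w12; ring.
  have w12z r : r ^+ 2 = c ^+ 2 - 4 * delta * s ^+ 2 -> w12 = 0.
    move=> rE; apply: (@frob_anti_sqrt w12 r k k0); first exact: frob_anti.
    by rewrite -rmorphXn rE q12.
  have s0 : s != 0.
    (* For s = 0 the three discriminants are the squares c^2, b^2 and 0 of elements of F, so all
       minors vanish, against freeness. *)
    apply/negP=> /eqP s0; have {}w12z : w12 = 0 by apply: (w12z c); rewrite s0; ring.
    have w02z : w02 = 0.
      apply: (@frob_anti_sqrt w02 b k k0); first exact: frob_anti.
      transitivity (iota b ^+ 2 - 4 * iota a * iota s); first by rewrite s0; ring.
      by rewrite ea eb es /w02; ring.
    have w01z : w01 = 0.
      apply: (@frob_anti_sqrt w01 0 k k0); first exact: frob_anti.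
      transitivity (0 ^+ 2 - 4 * iota a * (iota delta * iota s)).
        by rewrite s0; ring.
      by rewrite {1}e1 ed ea /w01; ring.
    by move: fr; rewrite w01z w02z w12z eqxx.
  split=> //; apply/negP=> /existsP[r /eqP rE].
  move: q12; rewrite (w12z r rE) mulr0 expr0n => /eqP; rewrite fmorph_eq0 subr_eq0.
  by move=> /eqP/nonsq_anisotropic[sz _]; rewrite sz eqxx in s0.
have [t tE tq] := frob_sqrt nsq.
have is0 : iota s != 0 by rewrite fmorph_eq0.
have t0 : t != 0.
  rewrite -sqrf_eq0 tE fmorph_eq0; apply: contra nsq => /eqP->.
  by apply/existsP; exists 0; rewrite expr0n.
have tE' : t ^+ 2 = iota c ^+ 2 - 4 * iota delta * iota s ^+ 2 by rewrite tE; ring.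
have aE : iota a * t ^+ 2 = - (iota delta * iota s * iota b ^+ 2).
  rewrite tE -!rmorphXn -!rmorphM -rmorphN; congr (iota _).
  by apply/eqP; rewrite -addr_eq0 -oppr_eq0 -conic_disc13 dE.
have := line_prod_split twoE is0 t0 tE' aE => /=.
set u := (_ + t) / _; set v := (_ - t) / _ => spl.
have iq x : iota x ^+ #|F| = iota x by exact: frob_rmorph.
have q2 : (2 * iota s)^-1 ^+ #|F| = (2 * iota s)^-1.
  by rewrite exprVn -[2](rmorph_nat iota) -rmorphM iq.
(* Negating t exchanges u and v, and hence the two factors. *)
have uq : u ^+ #|F| = v by rewrite exprMn (frobD iota) q2 iq tq.
exists s, (row3 (iota b * u / t) u 1); rewrite m13 frob_row3.
have -> : (iota b * u / t) ^+ #|F| = - (iota b * v / t).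
  by rewrite 2!exprMn exprVn iq uq tq invrN mulrN.
rewrite uq expr1n spl; split=> //.
rewrite row_free2; apply/or3P/Or33; rewrite mulr1 mul1r.
have -> : u - v = t / iota s by rewrite /u /v; field; rewrite is0 twoE.
by rewrite mulf_neq0 ?invr_eq0.
Qed.

End Classification.

(** * From hyperplanes to coefficient vectors *)

Section Hyperplanes.
Variable F : finFieldType.
Implicit Types (a b y : 'rV[F]_6) (L U : {set 'rV[F]_6}) (P : pred 'rV[F]_6).

Lemma mem_hyperplane a y : (y \in hyperplane a) = (a *m y^T == 0).
Proof.
rewrite inE; apply/eqP/eqP=> [e|/matrixP/(_ 0 0)].
  by apply/matrixP=> i j; rewrite !ord1 !mxE -[RHS]e; apply: eq_bigr => k _; rewrite mxE.
by rewrite !mxE => e; rewrite -[RHS]e; apply: eq_bigr => k _; rewrite mxE.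
Qed.

Lemma hyperplaneZ c a : c != 0 -> hyperplane (c *: a) = hyperplane a.
Proof.
move=> c0; apply/setP=> y; rewrite !mem_hyperplane -scalemxAl.
by rewrite scaler_eq0 (negPf c0).
Qed.

Lemma hyperplane_inj a b : a != 0 -> b != 0 ->
  hyperplane a = hyperplane b -> exists2 c, c != 0 & b = c *: a.
Proof.
move=> /rV0Pn[i ai] b0 eH.
have bE : b = (b 0 i / a 0 i) *: a.
  apply/rowP=> j.
  (* This vector lies in the hyperplane of [a]; its membership in that of [b] is the proportionality
     of coordinates i and j. *)
  pose y : 'rV_6 := a 0 i *: delta_mx 0 j - a 0 j *: delta_mx 0 i.
  have yE (z : 'rV[F]_6) : (y \in hyperplane z) = (a 0 i * z 0 j - a 0 j * z 0 i == 0).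
    rewrite mem_hyperplane linearB !linearZ /= !trmx_delta.
    rewrite mulmxDr -!scalemxAr mulmxN scalerN -!colE.
    apply/eqP/eqP=> [/matrixP/(_ 0 0)|e]; first by rewrite !mxE.
    by apply/matrixP=> u v; rewrite !ord1 !mxE.
  have : y \in hyperplane b by rewrite -eH yE mulrC subrr.
  rewrite yE subr_eq0 => /eqP e.
  by rewrite mxE; apply: (mulfI ai); rewrite e; field.
exists (b 0 i / a 0 i) => //; apply: contraNneq b0 => c0.
by rewrite bE c0 scale0r.
Qed.

Definition num_forms L P :=
  #|[set a | [&& a != 0, P a & L \subset hyperplane a]]|.

(** Each hyperplane comes from exactly the q - 1 nonzero multiples of one form. *)
Lemma num_containingE L P : (forall c a, c != 0 -> P (c *: a) = P a) ->
  num_forms L P = (num_containing L (hyperplanes P) * #|F|.-1)%N.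
Proof.
move=> PZ; rewrite /num_forms /num_containing -sum_nat_const -sum1_card.
rewrite (partition_big (@hyperplane F)
  (mem [set H in hyperplanes P | L \subset H])) /=; last first.
  move=> a; rewrite !inE => /and3P[a0 Pa ->]; rewrite andbT.
  by apply/imsetP; exists a; rewrite ?inE ?a0.
apply: eq_bigr => H; rewrite !inE => /andP[/imsetP[a]].
rewrite inE => /andP[a0 Pa] -> La; rewrite -(cardsC1 (0 : F)).
rewrite -(card_imset (f := fun c => c *: a) [set~ 0]); last first.
  by move=> c d /eqP; rewrite -subr_eq0 -scalerBl scaler_eq0 (negPf a0) orbF
    subr_eq0 => /eqP.
rewrite sum1_card; apply: eq_card => b; rewrite unfold_in inE.
apply/andP/imsetP=> [[/and3P[b0 Pb Lb] /eqP eH]|[c]].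
  by have [c c0 ->] := hyperplane_inj a0 b0 (esym eH); exists c; rewrite ?inE.
rewrite !inE => c0 ->.
by rewrite hyperplaneZ // scaler_eq0 negb_or c0 a0 PZ // Pa La eqxx.
Qed.

(** Congruence by [A] is a bijection from the forms vanishing on the image of [U] to those vanishing
    on [U]. *)
Lemma num_forms_K_act A U P : (2 : F) != 0 -> A \in unitmx ->
  (forall a, P (conic_congr A a) = P a) ->
  num_forms (K_act A @: U) P = num_forms U P.
Proof.
move=> two uA PA; rewrite /num_forms.
have inj := can_inj (conic_congrK two uA).
have congr0 : conic_congr A 0 = 0.
  by rewrite -[X in conic_congr A X](scale0r (0 : 'rV[F]_6)) conic_congrZ // scale0r.
rewrite -[RHS](card_preimset _ inj); apply: eq_card => a; rewrite !inE PA.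
by rewrite subset_hyperplane_K_act // -{2}congr0 (inj_eq inj).
Qed.

Lemma congr_invariant P : (2 : F) != 0 ->
  (forall A a, A \in unitmx -> P a -> P (conic_congr A a)) ->
  forall A a, A \in unitmx -> P (conic_congr A a) = P a.
Proof.
move=> two PA A a uA; apply/idP/idP; last exact: PA.
by move=> /(PA (invmx A)); rewrite unitmx_inv conic_congrK // => /(_ uA).
Qed.

End Hyperplanes.

(** * Invariance of the four types under scaling and congruence *)

Section Invariance.
Variables (F E : finFieldType) (iota : {rmorphism F -> E}).
Hypotheses (quadE : #|E| = (#|F| ^ 2)%N) (odd_q : odd #|F|).
Let two : (2 : F) != 0 := odd_card_two_neq0 odd_q.
Let twoE : (2 : E) != 0.
Proof. by apply: odd_card_two_neq0; rewrite quadE oddX. Qed.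
Implicit Types (a : 'rV[F]_6) (c : F) (A : 'M[F]_3).

Lemma scale_invariant (P : pred 'rV[F]_6) :
  (forall c a, c != 0 -> P a -> P (c *: a)) ->
  forall c a, c != 0 -> P (c *: a) = P a.
Proof.
move=> PZ c a c0; apply/idP/idP; last exact: PZ.
by move=> /(PZ c^-1); rewrite invr_eq0 scalerA mulVf // scale1r => /(_ c0).
Qed.

Lemma row_free_mulmx_unit (R : fieldType) (l m : 'rV[R]_3) (A : 'M[R]_3) :
  A \in unitmx -> row_free (col_mx (l *m A) (m *m A)) = row_free (col_mx l m).
Proof. by move=> uA; rewrite -mul_col_mx /row_free mxrankMfree ?row_free_unit. Qed.

Lemma double_lineZ c a : c != 0 -> double_line (c *: a) = double_line a.
Proof.
apply: (scale_invariant (P := @double_line F)) => {}c {}a _ /double_lineP[k [l ->]].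
by apply/double_lineP; exists (c * k), l; rewrite scalerA.
Qed.

Lemma double_line_congr A a :
  A \in unitmx -> double_line (conic_congr A a) = double_line a.
Proof.
apply: (congr_invariant two) A a => A a _ /double_lineP[k [l ->]].
apply/double_lineP; exists k, (l *m A).
by rewrite conic_congrZ // conic_congr_line_prod.
Qed.

Lemma real_line_pairZ c a : c != 0 -> real_line_pair (c *: a) = real_line_pair a.
Proof.
apply: (scale_invariant (P := @real_line_pair F)) => {}c {}a c0.
move=> /real_line_pairP[l [m [fr ->]]].
apply/real_line_pairP; exists (c *: l), m; rewrite line_prodZl; split=> //.
move: fr; have [x0 [x1 [x2 ->]]] := row3P l; have [y0 [y1 [y2 ->]]] := row3P m.
have -> : c *: row3 x0 x1 x2 = row3 (c * x0) (c * x1) (c * x2).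
  by apply/rowP=> k; rewrite !mxE; case: k => [[|[|[|k]]] ?].
by rewrite !row_free2 -!mulrA -!mulrBr !mulf_eq0 (negPf c0).
Qed.

Lemma real_line_pair_congr A a :
  A \in unitmx -> real_line_pair (conic_congr A a) = real_line_pair a.
Proof.
apply: (congr_invariant two) A a => A a uA.
move=> /real_line_pairP[l [m [fr ->]]]; apply/real_line_pairP.
exists (l *m A), (m *m A).
by rewrite conic_congr_line_prod // row_free_mulmx_unit.
Qed.

Lemma imaginary_line_pairZ c a :
  c != 0 -> imaginary_line_pair iota (c *: a) = imaginary_line_pair iota a.
Proof.
apply: (scale_invariant (P := imaginary_line_pair iota)) => {}c {}a _.
move=> /imaginary_line_pairP[k [l [fr e]]]; apply/imaginary_line_pairP.
by exists (c * k), l; rewrite map_mxZ e scalerA rmorphM.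
Qed.

Lemma imaginary_line_pair_congr A a : A \in unitmx ->
  imaginary_line_pair iota (conic_congr A a) = imaginary_line_pair iota a.
Proof.
apply: (congr_invariant two) A a => A a uA.
move=> /imaginary_line_pairP[k [l [fr e]]]; apply/imaginary_line_pairP.
exists k, (l *m map_mx iota A); rewrite frob_mxM; split.
  by rewrite row_free_mulmx_unit ?map_unitmx.
by rewrite (map_conic_congr iota quadE odd_q) e conic_congrZ // conic_congr_line_prod.
Qed.

Lemma nonsingular_conicZ c a :
  c != 0 -> nonsingular_conic (c *: a) = nonsingular_conic a.
Proof.
by move=> c0; rewrite /nonsingular_conic conic_discZ mulf_eq0 expf_eq0 (negPf c0).
Qed.

Lemma nonsingular_conic_congr A a :
  A \in unitmx -> nonsingular_conic (conic_congr A a) = nonsingular_conic a.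
Proof.
have ns (b : 'rV[F]_6) : nonsingular_conic b = (\det (gram b) != 0).
  by rewrite det_gram mulf_eq0 (negPf two).
rewrite unitmxE unitfE !ns gram_congr // !det_mulmx det_tr => dA.
by rewrite !mulf_eq0 (negPf dA) orbF.
Qed.

End Invariance.

(** * Parametrization of the conics through the representative line *)

Section Count.
Variable F : finFieldType.
Hypothesis odd_q : odd #|F|.
Let two : (2 : F) != 0 := odd_card_two_neq0 odd_q.
Let four : (4 : F) != 0.
Proof. by rewrite (_ : 4 = 2 * 2) ?mulf_neq0 //; ring. Qed.
Variable delta : F.
Hypothesis nonsq_delta : forall x : F, x ^+ 2 != delta.

Let delta_neq0 : delta != 0.
Proof. by rewrite eq_sym -[0](mul0r 0) -expr2. Qed.

(** The ratios e = c / s for which a singular conic with s <> 0 splits over F. *)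
Definition split_set : {set F} := [set e | is_sq (e ^+ 2 - 4 * delta)].

(* The hyperbola e^2 - d^2 = 4 delta is parametrized by u = e + d <> 0, and
   d <> 0 on it because delta is not a square. *)
Lemma card_split_set : (#|split_set| * 2 = #|F|.-1)%N.
Proof.
rewrite -(cardsC1 (0 : F)) -[in RHS]sum1_card.
pose f u := (u + 4 * delta / u) / 2.
rewrite (partition_big f (mem split_set)) /=; last first.
  move=> u; rewrite !inE => u0; apply/existsP; exists ((u - 4 * delta / u) / 2).
  by apply/eqP; rewrite /f; field; rewrite u0 two.
rewrite -sum_nat_const; apply: eq_bigr => e; rewrite inE => /existsP[d /eqP dE].
have prod4 : (e + d) * (e - d) = 4 * delta.
  by transitivity (e ^+ 2 - d ^+ 2); [ring | rewrite dE; ring].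
have nz : (e + d) * (e - d) != 0 by rewrite prod4 mulf_neq0.
have [p0 m0] : e + d != 0 /\ e - d != 0.
  by move: nz; rewrite mulf_eq0 negb_or => /andP.
have d0 : d != 0.
  apply/eqP=> d0; case/eqP: (nonsq_delta (e / 2)).
  apply: (mulfI four); rewrite -prod4 d0; field; exact: two.
have ne : e + d != e - d.
  rewrite -subr_eq0; have -> : e + d - (e - d) = 2 * d by ring.
  by rewrite mulf_neq0.
symmetry; rewrite sum1_card; transitivity #|[set e + d; e - d]|; last by rewrite cards2 ne.
apply: eq_card => u; rewrite unfold_in !inE; apply/andP/orP=> [[u0 /eqP fu]|].
  have : (u - (e + d)) * (u - (e - d)) == 0.
    apply/eqP; transitivity (u ^+ 2 - 2 * e * u + (e + d) * (e - d)); first ring.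
    by rewrite prod4 -fu /f; field; rewrite u0 two.
  by rewrite mulf_eq0 !subr_eq0 => /orP[]; [left|right].
case=> /eqP ->; split=> //; apply/eqP; rewrite /f -prod4; field.
  by rewrite two p0.
by rewrite two m0.
Qed.

(** Tuples [(a, ((b, c), s))], grouped so that the loci with s = 0 are product sets. *)
Definition params := (F * ((F * F) * F))%type.

Definition conic13_of (p : params) :=
  conic13 delta p.1 p.2.1.1 p.2.1.2 p.2.2.

Lemma conic13_of_inj : injective conic13_of.
Proof.
move=> [a [[b c] s]] [a' [[b' c'] s']].
by rewrite /conic13_of /conic13 /= => /row6_inj[[-> _ ->] [_ -> ->]].
Qed.

Lemma conic13_of_neq0 p : (conic13_of p != 0) = (p != (0, ((0, 0), 0))).
Proof.
rewrite -(inj_eq conic13_of_inj); congr (_ != _).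
apply/esym/eqP; rewrite /conic13_of /conic13 row6_eq0 /= mulr0 !eqxx //.
Qed.

(** The two points (x, y) = (1, 0) and (0, 1) span the line and give one linear condition each. *)
Lemma line13_2_subset_hyperplane a :
  (line13_2 delta \subset hyperplane a) = (a \in codom conic13_of).
Proof.
have [x0 [x1 [x2 [x3 [x4 [x5 ->]]]]]] := row6P a.
have memE x y : (sym_coords (line13_2_mx delta x y) \in
    hyperplane (row6 x0 x1 x2 x3 x4 x5)) = (x1 * x + (x3 - delta * x5) * y == 0).
  rewrite inE sum_ord6 -[sym_coords _]/(row6 _ _ _ _ _ _) !row6E !inordK //=.
  by rewrite !mxE /=; congr (_ == _); ring.
apply/subsetP/codomP=> [sub|[[a' [[b c] s]]] e y].
  have mem x y : x1 * x + (x3 - delta * x5) * y == 0.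
    by rewrite -memE sub //; apply/imset2P; exists x y.
  exists (x0, ((x2, x4), x5)); rewrite /conic13_of /conic13 /=.
  have := mem 1 0; rewrite mulr1 mulr0 addr0 => /eqP ->.
  by have := mem 0 1; rewrite mulr1 mulr0 add0r subr_eq0 => /eqP ->.
case/imset2P=> u v _ _ ->; rewrite memE.
by have /row6_inj[[_ -> _] [-> _ ->]] := e; rewrite mul0r add0r subrr mul0r.
Qed.

Lemma num_forms_line13_2 (P : pred 'rV[F]_6) : num_forms (line13_2 delta) P =
  #|[set p : params | (p != (0, ((0, 0), 0))) && P (conic13_of p)]|.
Proof.
rewrite -(card_imset _ conic13_of_inj); apply: eq_card => a.
rewrite !inE line13_2_subset_hyperplane.
apply/and3P/imsetP=> [[a0 Pa /codomP[p aE]]|[p]].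
  by exists p => //; rewrite inE -conic13_of_neq0 -aE a0.
by rewrite inE -conic13_of_neq0 => /andP[p0 Pp] ->; split=> //; apply: codom_f.
Qed.

(** With c = s e, the equation of singularity is solved for [a]; the denominator is nonzero when s
    is, as delta is a non-square. *)
Definition cone_param (p : F * (F * F)) : params :=
  let: (s, (b, e)) := p in
  (- (delta * b ^+ 2) / (s * (e ^+ 2 - 4 * delta)), ((b, s * e), s)).

Definition cone_set (C : {set F}) : {set params} :=
  cone_param @: setX [set~ 0] (setX setT C).

Lemma card_cone_set C : #|cone_set C| = (#|F|.-1 * (#|F| * #|C|))%N.
Proof.
rewrite card_in_imset ?cardsX ?cardsC1 ?cardsT //.
move=> [s [b e]] [s' [b' e']]; rewrite !inE /= => /andP[s0 _] _.
by case=> _ -> + ss; rewrite -ss => /(mulfI s0) ->.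
Qed.

Lemma in_cone_set C a b c s : ((a, ((b, c), s)) \in cone_set C) =
  [&& conic_disc (conic13 delta a b c s) == 0, s != 0 & c / s \in C].
Proof.
have nz e : e ^+ 2 - 4 * delta != 0.
  rewrite subr_eq0; apply/eqP=> eE; case/eqP: (nonsq_delta (e / 2)).
  by rewrite expr_div_n eE; field; rewrite ?two ?four.
rewrite conic_disc13 oppr_eq0.
apply/imsetP/and3P=> [[[s' [b' e]]]|[/eqP dE s0 cC]].
  rewrite !inE /= => /andP[s0 eC] [-> -> -> ->]; split=> //.
    by apply/eqP; field; rewrite s0 nz.
  by rewrite mulrC mulKf.
exists (s, (b, c / s)); first by rewrite !inE /= s0.
rewrite /cone_param; congr (_, ((_, _), _)); last by field.
have D0 : c ^+ 2 - 4 * delta * s ^+ 2 != 0.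
  have -> : c ^+ 2 - 4 * delta * s ^+ 2 = s ^+ 2 * ((c / s) ^+ 2 - 4 * delta).
    by field.
  by rewrite mulf_neq0 // expf_neq0.
apply: (mulIf D0); move/eqP: dE; rewrite addr_eq0 => /eqP ->; field.
by rewrite s0 mulNr D0.
Qed.

Lemma is_sq_scale c s : s != 0 ->
  is_sq (c ^+ 2 - 4 * delta * s ^+ 2) = (c / s \in split_set).
Proof.
move=> s0; rewrite inE; apply/existsP/existsP=> -[x /eqP xE].
  by exists (x / s); apply/eqP; rewrite expr_div_n xE; field.
by exists (x * s); apply/eqP; rewrite exprMn xE; field.
Qed.

End Count.

(** * Counts of forms of each type *)

Section Distribution.
Variables (F E : finFieldType) (iota : {rmorphism F -> E}).
Hypotheses (quadE : #|E| = (#|F| ^ 2)%N) (odd_q : odd #|F|).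
Variable delta : F.
Hypothesis nonsq_delta : forall x : F, x ^+ 2 != delta.

Let inX := (in_setX, in_setU, in_setC1, in_set1, in_setT, xpair_eqE).

Lemma num_double13 : num_forms (line13_2 delta) (@double_line F) = #|F|.-1.
Proof.
rewrite num_forms_line13_2.
(* The double lines are the nonzero multiples of X^2. *)
have -> : #|F|.-1 = #|setX [set~ 0 : F] [set ((0 : F, 0 : F), 0 : F)]|.
  by rewrite cardsX cardsC1 cards1 muln1.
apply: eq_card => -[a [[b c] s]]; rewrite in_set /conic13_of double_line13 // !inX /=.
by do !case: eqP.
Qed.

Lemma card_setU_disjoint (T : finType) (A B : {set T}) :
  (forall x, x \in A -> x \notin B) -> #|A :|: B| = (#|A| + #|B|)%N.
Proof.
move=> AB; apply/eqP; rewrite (leq_card_setU A B).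
by apply/pred0P=> x /=; apply/andP=> -[/AB/negP].
Qed.

Lemma conic_disc13_s0 a b c :
  (conic_disc (conic13 delta a b c 0) == 0) = (a == 0) || (c == 0).
Proof.
rewrite conic_disc13 oppr_eq0.
rewrite (_ : _ + _ = a * c ^+ 2); last by ring.
by rewrite mulf_eq0 sqrf_eq0.
Qed.

(** Three disjoint families: a = s = 0 with (b, c) nonzero; c = s = 0 with a and b nonzero; s <> 0
    with c / s in [split_set]. *)
Lemma num_real13 : num_forms (line13_2 delta) (@real_line_pair F) =
  ((#|F| ^ 2).-1 + #|F|.-1 * #|F|.-1 + #|F|.-1 * (#|F| * #|split_set delta|))%N.
Proof.
rewrite num_forms_line13_2 -(card_cone_set delta).
pose A : {set params F} := setX [set 0] (setX [set~ (0, 0)] [set 0]).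
pose B : {set params F} := setX [set~ 0] (setX (setX [set~ 0] [set 0]) [set 0]).
have -> : (#|F| ^ 2).-1 = #|A|.
  by rewrite !cardsX !cards1 cardsC1 card_prod mulnn mul1n muln1.
have -> : (#|F|.-1 * #|F|.-1)%N = #|B|.
  by rewrite !cardsX !cards1 !cardsC1 !muln1.
rewrite -!card_setU_disjoint; first last.
- by move=> [a [[b c] s]]; rewrite !inX /= => /andP[/eqP->]; rewrite eqxx.
- move=> [a [[b c] s]]; rewrite in_cone_set // !inX.
  by case: (s == 0); rewrite ?andbF.
apply: eq_card => -[a [[b c] s]].
rewrite in_set /conic13_of real_line_pair13 // in_setU in_cone_set // !inX /=.
have [->|s0] := eqVneq s 0.
  rewrite conic_disc13_s0 !andbF !andbT !orbF.
  by do 3!case: eqP.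
by rewrite !andbF -is_sq_scale.
Qed.

Lemma num_imaginary13 :
  num_forms (line13_2 delta) (imaginary_line_pair iota) =
  (#|F|.-1 * (#|F| * #|~: split_set delta|))%N.
Proof.
rewrite num_forms_line13_2 -(card_cone_set delta).
apply: eq_card => -[a [[b c] s]].
(* The condition on parameters is turned into nonvanishing of the form, which the classification of
   imaginary pairs requires. *)
rewrite in_cone_set // inE -[_ != (0, _)](conic13_of_neq0 delta).
rewrite /conic13_of /=.
have [s0|s0] := eqVneq s 0; last first.
  have nz : conic13 delta a b c s != 0 by rewrite row6_eq0 (negPf s0) !andbF.
  by rewrite imaginary_line_pair13 // nz s0 is_sq_scale // in_setC.
rewrite andbF; apply/andP=> -[nz]; rewrite imaginary_line_pair13 //.
by rewrite s0 eqxx andbF.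
Qed.

(** Complementary count, kept additive to avoid truncated subtraction. The singular forms, zero
    included, are those with a = s = 0, those with a <> 0 and c = s = 0, and the cone over all
    ratios. *)
Lemma num_nonsingular13 :
  (num_forms (line13_2 delta) (@nonsingular_conic F) +
   (#|F| ^ 2 + #|F|.-1 * #|F| + #|F|.-1 * (#|F| * #|F|)) = #|F| ^ 4)%N.
Proof.
pose A : {set params F} := setX [set 0] (setX setT [set 0]).
pose B : {set params F} := setX [set~ 0] (setX (setX setT [set 0]) [set 0]).
have -> : (#|F| ^ 2)%N = #|A|.
  by rewrite !cardsX !cards1 cardsT card_prod mulnn mul1n muln1.
have -> : (#|F|.-1 * #|F|)%N = #|B|.
  by rewrite !cardsX !cards1 cardsT cardsC1 !muln1.
have -> : (#|F|.-1 * (#|F| * #|F|))%N = #|cone_set delta setT|.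
  by rewrite card_cone_set cardsT.
rewrite num_forms_line13_2 -[(#|A| + #|B|)%N]card_setU_disjoint; last first.
  by move=> [a [[b c] s]]; rewrite !inX /= => /andP[/eqP->]; rewrite eqxx.
rewrite -[(_ + #|cone_set _ _|)%N]card_setU_disjoint; last first.
  move=> [a [[b c] s]]; rewrite in_cone_set // !inX.
  by case: (s == 0); rewrite ?andbF.
set Z := _ :|: _; have -> : (#|F| ^ 4)%N = #|{: params F}|.
  by rewrite !card_prod !expnS expn0 muln1 !mulnA.
rewrite -(cardsC Z) addnC; congr (_ + _)%N.
apply: eq_card => -[a [[b c] s]]; rewrite in_setC !inX in_cone_set // in_setT.
rewrite in_set /conic13_of /nonsingular_conic /=.
have [->|s0] := eqVneq s 0.
  by rewrite conic_disc13_s0 !xpair_eqE eqxx; do 3!case: eqP.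
by rewrite !xpair_eqE (negPf s0) !andbF /= andbT.
Qed.

End Distribution.

(** * Transfer to the representative line and division by q - 1 *)

Theorem lemma4p12 (F E : finFieldType) (iota : {rmorphism F -> E})
    (quadE : #|E| = (#|F| ^ 2)%N) (odd_q : odd #|F|)
    (delta : F) (nonsq_delta : forall x : F, x ^+ 2 != delta)
    (L : {set 'rV[F]_6}) (L_o13_2 : L \in o13_2 delta) :
  let q := #|F| in
  OD4 iota L =
    [:: 1; (q ^ 2 + 3 * q) %/ 2; (q ^ 2 + q) %/ 2; q ^ 3 - q]%N.
Proof.
have two := odd_card_two_neq0 odd_q.
case/imsetP: L_o13_2 => A uA LE q.
have num P : (forall c a, c != 0 -> P (c *: a) = P a) ->
    (forall a, P (conic_congr A a) = P a) ->
    (num_containing L (hyperplanes P) * q.-1)%N = num_forms (line13_2 delta) P.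
  by move=> PZ PA; rewrite -num_containingE // LE num_forms_K_act.
have q1 : (1 < q)%N := finRing_gt1 F.
have cancel m n : (m * q.-1)%N = (n * q.-1)%N -> m = n.
  by move/eqP; rewrite eqn_pmul2r; [move/eqP | rewrite -ltnS prednK // ltnW].
(* With k = (q - 1) / 2, so that q = 2 k + 1, k ratios split and the other k + 1 do not. *)
pose k := #|split_set delta|.
have qE : q = (k * 2).+1 by rewrite (card_split_set odd_q) // prednK // ltnW.
have kC : #|~: split_set delta| = k.+1.
  by apply/eqP; rewrite -(eqn_add2l k) cardsC -/q qE; apply/eqP; lia.
rewrite /OD4; congr [:: _; _; _; _]; apply: cancel.
- rewrite (num _ (@double_lineZ F) (fun a => double_line_congr odd_q a uA)).
  by rewrite num_double13 // mul1n.
- rewrite (num _ (@real_line_pairZ F) (fun a => real_line_pair_congr odd_q a uA)).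
  rewrite num_real13 // -/q -/k qE.
  (* Written as an explicit double, the numerator is divided exactly by [%/ 2]. *)
  have -> : (((k * 2).+1 ^ 2 + 3 * (k * 2).+1) = (2 * k ^ 2 + 5 * k + 2) * 2)%N.
    by rewrite !expnS !expn0; nia.
  by rewrite mulnK // !expnS !expn0; nia.
- rewrite (num _ (imaginary_line_pairZ iota)
    (fun a => imaginary_line_pair_congr iota quadE odd_q a uA)).
  rewrite num_imaginary13 // kC -/q qE.
  have -> : (((k * 2).+1 ^ 2 + (k * 2).+1) = (2 * k ^ 2 + 3 * k + 1) * 2)%N.
    by rewrite !expnS !expn0; nia.
  by rewrite mulnK // !expnS !expn0; nia.
rewrite (num _ (@nonsingular_conicZ F)
  (fun a => nonsingular_conic_congr odd_q a uA)).
(* What remains is q^4 - q^2 - (q - 1) q - (q - 1) q^2 = (q - 1)(q^3 - q). *)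
have := num_nonsingular13 odd_q nonsq_delta; rewrite -/q qE.
rewrite !expnS !expn0 /=; nia.
Qed.
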